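(* For $\mathbf x=(x_1,\ldots,x_7)\in\mathbb C^7$ the following are equivalent. (1) $\mathbf x\in G_{E(3;3;1,1,1)}$. (2) There exists $A=((a_{ij}))\in\mathcal M_{3\times 3}(\mathbb C)$ such that $x_1=a_{11}$, $x_2=a_{22}$, $x_3=a_{11}a_{22}-a_{12}a_{21}$, $x_4=a_{33}$, $x_5=a_{11}a_{33}-a_{13}a_{31}$, $x_6=a_{22}a_{33}-a_{23}a_{32}$, $x_7=\det A$, and such that for all $z_2,z_3\in\bar{\mathbb D}$ $$\det\left(I_2-\begin{pmatrix}a_{22}&a_{23}\\ a_{32}&a_{33}\end{pmatrix}\begin{pmatrix}z_2&0\\ 0&z_3\end{pmatrix}\right)\neq0$$ and $$(1-|z_2|^2)|\tilde\gamma_1(z_2,z_3)|^2+(1-|z_3|^2)|\tilde\gamma_2(z_2,z_3)|^2+\tilde\eta(z_2,z_3)^*(I_3-A^*A)\tilde\eta(z_2,z_3)>0 .$$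
   Context: $\bar{\mathbb D}$ is the closed unit disc. For a linear subspace $E$ of $\mathcal M_{n\times n}(\mathbb C)$, $\mu_E(A)=1/\inf\{\|X\|: X\in E,\ \det(I-AX)=0\}$, with $\mu_E(A)=0$ if $I-AX$ is nonsingular for all $X\in E$ (operator norm). $E(3;3;1,1,1)$ is the space of $3\times 3$ diagonal matrices, and $G_{E(3;3;1,1,1)}=\{\pi(A): A\in\mathcal M_{3\times3}(\mathbb C),\ \mu_{E(3;3;1,1,1)}(A)<1\}$ where $$\pi(A)=\big(a_{11},\ a_{22},\ a_{11}a_{22}-a_{12}a_{21},\ a_{33},\ a_{11}a_{33}-a_{13}a_{31},\ a_{22}a_{33}-a_{23}a_{32},\ \det A\big).$$ For $A\in\mathcal M_{3\times3}(\mathbb C)$ and $z_2,z_3\in\mathbb C$ with $\det\left(I_2-\begin{pmatrix}a_{22}&a_{23}\\ a_{32}&a_{33}\end{pmatrix}\begin{pmatrix}z_2&0\\ 0&z_3\end{pmatrix}\right)\ne0$, define $$\begin{pmatrix}\tilde\gamma_1(z_2,z_3)\\ \tilde\gamma_2(z_2,z_3)\end{pmatrix}=\left(I_2-\begin{pmatrix}a_{22}&a_{23}\\ a_{32}&a_{33}\end{pmatrix}\begin{pmatrix}z_2&0\\ 0&z_3\end{pmatrix}\right)^{-1}\begin{pmatrix}a_{21}\\ a_{31}\end{pmatrix},\qquad \tilde\eta(z_2,z_3)=\begin{pmatrix}1\\ z_2\tilde\gamma_1(z_2,z_3)\\ z_3\tilde\gamma_2(z_2,z_3)\end{pmatrix}.$$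 *)

(* Defs.v *)
From mathcomp Require Import all_boot all_order all_algebra.
From mathcomp Require Import boolp classical_sets reals.
From mathcomp Require Import complex.

Set Implicit Arguments.
Unset Strict Implicit.
Unset Printing Implicit Defensive.

Import Order.TTheory GRing.Theory Num.Theory.

Local Open Scope classical_set_scope.
Local Open Scope ring_scope.
Local Open Scope sesquilinear_scope.

(* In R[i], `|z| is the modulus seen as a complex number, [a < b] and [a <= b]
   also assert that b - a is real, and M ^t* is the conjugate transpose.
   Indices of vectors and matrices start at 0. *)

Section StructuredSingularValue.
Variables (R : realType) (n : nat).

Definition euclidean_norm (v : 'cV[R[i]]_n) : R :=
  Num.sqrt (\sum_i ComplexField.Normc.normc (v i 0) ^+ 2).

(* The library's norm on matrices is the sup norm of the entries. *)
Definition operator_norm (X : 'M[R[i]]_n) : R :=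
  sup [set euclidean_norm (X *m v) | v in [set v | euclidean_norm v <= 1]].

Definition singularizing (E : set 'M[R[i]]_n) (A : 'M[R[i]]_n) :
    set 'M[R[i]]_n :=
  [set X | E X /\ \det (1%:M - A *m X) = 0].

(* E is meant to be a linear subspace.  A member X of [singularizing E A]
   satisfies operator_norm A * operator_norm X >= 1, so the infimum below is
   positive and the inverse is never that of 0. *)
Definition mu (E : set 'M[R[i]]_n) (A : 'M[R[i]]_n) : R :=
  if `[< singularizing E A !=set0 >]
  then (inf [set operator_norm X | X in singularizing E A])^-1
  else 0.

Definition diagonal_matrices : set 'M[R[i]]_n := [set X | is_diag_mx X].

End StructuredSingularValue.

Section Domain.
Variable R : realType.

Definition E_3_3_111 : set 'M[R[i]]_3 := @diagonal_matrices R 3.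

Definition pi_3_3_111 (A : 'M[R[i]]_3) : 'rV[R[i]]_7 :=
  \row_(k < 7)
    [:: A 0 0;
        A 1 1;
        A 0 0 * A 1 1 - A 0 1 * A 1 0;
        A 2 2;
        A 0 0 * A 2 2 - A 0 2 * A 2 0;
        A 1 1 * A 2 2 - A 1 2 * A 2 1;
        \det A]`_k.

Definition G_3_3_111 : set 'rV[R[i]]_7 :=
  [set pi_3_3_111 A | A in [set A | mu E_3_3_111 A < 1]].

Definition resolvent_mx (A : 'M[R[i]]_3) (z2 z3 : R[i]) : 'M[R[i]]_2 :=
  1%:M - drsubmx (A : 'M_(1 + 2)) *m diag_mx (\row_(k < 2) [:: z2; z3]`_k).

Definition gamma_vec (A : 'M[R[i]]_3) (z2 z3 : R[i]) : 'cV[R[i]]_2 :=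
  invmx (resolvent_mx A z2 z3) *m dlsubmx (A : 'M_(1 + 2)).

Definition gamma1 A z2 z3 : R[i] := gamma_vec A z2 z3 0 0.
Definition gamma2 A z2 z3 : R[i] := gamma_vec A z2 z3 1 0.

Definition eta (A : 'M[R[i]]_3) (z2 z3 : R[i]) : 'cV[R[i]]_3 :=
  \col_(k < 3) [:: 1; z2 * gamma1 A z2 z3; z3 * gamma2 A z2 z3]`_k.

End Domain.

(* Main.v *)
Require Import Defs.
From mathcomp Require Import all_boot all_order all_algebra.
From mathcomp Require Import boolp classical_sets reals.
From mathcomp Require Import topology normedtype derive.
From mathcomp Require Import complex ring lra.

(** Put G = (A eta)_1.  Since the last two coordinates of A eta are gamma_1 and
    gamma_2, the expression in (2) equals 1 - |G(z2,z3)|^2; and a Schur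
    complement gives
      det(I - A diag(z1,z2,z3)) = det(I_2 - A' diag(z2,z3)) (1 - z1 G(z2,z3)).
    Hence (2) says that det(I - A diag(z)) has no zero on the closed unit
    polydisc.  A diagonal matrix has operator norm max |z_k|, so mu(A) < 1 says
    that the zeros stay outside a polydisc of some radius > 1; by compactness
    the two conditions agree. *)

Set Implicit Arguments.
Unset Strict Implicit.
Unset Printing Implicit Defensive.

Import Order.TTheory GRing.Theory Num.Theory.
Import numFieldNormedType.Exports.

Local Open Scope classical_set_scope.
Local Open Scope ring_scope.
Local Open Scope sesquilinear_scope.

(** * Continuity of complex-valued maps, through real and imaginary parts *)

Section ContinuousComplex.
Variables (R : realType) (T : topologicalType).
Implicit Types f g : T -> R[i].

(* [R[i]] itself is not a topological type, whence the two parts. *)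
Definition Ccontinuous f :=
  continuous (fun t => complex.Re (f t) : R) /\
  continuous (fun t => complex.Im (f t) : R).

Lemma Ccontinuous_cst (c : R[i]) : Ccontinuous (fun=> c).
Proof. by split=> x; exact: cvg_cst. Qed.

Lemma CcontinuousD f g :
  Ccontinuous f -> Ccontinuous g -> Ccontinuous (fun t => f t + g t).
Proof.
move=> [f1 f2] [g1 g2]; split=> x.
  under eq_fun do rewrite raddfD; exact: (cvgD (f1 x) (g1 x)).
under eq_fun do rewrite raddfD; exact: (cvgD (f2 x) (g2 x)).
Qed.

Lemma CcontinuousM f g :
  Ccontinuous f -> Ccontinuous g -> Ccontinuous (fun t => f t * g t).
Proof.
move=> [f1 f2] [g1 g2]; split=> x.
  have -> : (fun t => complex.Re (f t * g t)) =
            (fun t => complex.Re (f t) * complex.Re (g t) -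
                      complex.Im (f t) * complex.Im (g t)).
    by apply/funext => t; case: (f t) (g t) => a b [].
  exact: (cvgB (cvgM (f1 x) (g1 x)) (cvgM (f2 x) (g2 x))).
have -> : (fun t => complex.Im (f t * g t)) =
          (fun t => complex.Re (f t) * complex.Im (g t) +
                    complex.Im (f t) * complex.Re (g t)).
  by apply/funext => t; case: (f t) (g t) => a b [].
exact: (cvgD (cvgM (f1 x) (g2 x)) (cvgM (f2 x) (g1 x))).
Qed.

Lemma Ccontinuous_sum I (r : seq I) (P : pred I) (F : I -> T -> R[i]) :
  (forall i, Ccontinuous (F i)) ->
  Ccontinuous (fun t => \sum_(i <- r | P i) F i t).
Proof.
move=> cF; elim: r => [|i r IHr].
  under eq_fun do rewrite big_nil; exact: Ccontinuous_cst.
under eq_fun do rewrite big_cons; case: (P i) => //; exact: CcontinuousD.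
Qed.

Lemma Ccontinuous_prod I (r : seq I) (P : pred I) (F : I -> T -> R[i]) :
  (forall i, Ccontinuous (F i)) ->
  Ccontinuous (fun t => \prod_(i <- r | P i) F i t).
Proof.
move=> cF; elim: r => [|i r IHr].
  under eq_fun do rewrite big_nil; exact: Ccontinuous_cst.
under eq_fun do rewrite big_cons; case: (P i) => //; exact: CcontinuousM.
Qed.

Lemma Ccontinuous_det n (M : T -> 'M[R[i]]_n) :
  (forall i j, Ccontinuous (fun t => M t i j)) ->
  Ccontinuous (fun t => \det (M t)).
Proof.
move=> cM; apply: Ccontinuous_sum => s; apply: CcontinuousM.
  exact: Ccontinuous_cst.
by apply: Ccontinuous_prod => i; exact: cM.
Qed.

Lemma Ccontinuous_closed_eq0 f : Ccontinuous f -> closed [set t | f t = 0].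
Proof.
move=> [f1 f2].
have -> : [set t | f t = 0] =
    (fun t => complex.Re (f t)) @^-1` [set 0] `&`
    (fun t => complex.Im (f t)) @^-1` [set 0].
  apply/seteqP; split=> t /=; first by move=> ->.
  by case: (f t) => a b /= [-> ->].
by apply: closedI; apply: preimage_closed.
Qed.

End ContinuousComplex.

(** * Zero-free polydiscs and the singular value for diagonal matrices *)

Section DiagonalSingularValue.
Variables (R : realType) (n : nat).
Implicit Types (z : 'rV[R[i]]_n) (v : 'cV[R[i]]_n) (r : R).
Local Open Scope complex_scope.

Definition polydisc r : set 'rV[R[i]]_n :=
  [set z | forall k, `|z 0 k| <= r%:C].

(** The zeros of radius at most r + 1 form a compact set, so the least radius of a zero is attained
    and must exceed r; if there are none, r + 1 itself will do. *)
Lemma det_neq0_polydisc_extend (A : 'M[R[i]]_n) (r : R) : 0 <= r ->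
  (forall z, polydisc r z -> \det (1%:M - A *m diag_mx z) != 0) ->
  exists2 r' : R, r < r' &
    forall z, polydisc r' z -> \det (1%:M - A *m diag_mx z) != 0.
Proof.
move=> r0 nz.
(* A point of [T] is (s, Re w, Im w), so that compactness is used in real coordinates only. *)
pose T : topologicalType := (R * ('rV[R]_n * 'rV[R]_n))%type.
pose w (t : T) : 'rV[R[i]]_n := \row_k (t.2.1 0 k +i* t.2.2 0 k).
pose p (t : T) := \det (1%:M - A *m diag_mx (t.1%:C *: w t)).
have c1 : continuous (fun t : T => t.1 : R) by move=> t; exact: cvg_fst.
have cre k : continuous (fun t : T => t.2.1 0 k : R).
  move=> t.
  apply: (@continuous_comp _ _ _ (fun t : T => t.2.1) (fun u => u 0 k)).
    apply: (@continuous_comp _ _ _ (fun t : T => t.2) fst).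
      exact: cvg_snd.
    exact: cvg_fst.
  exact: coord_continuous.
have cim k : continuous (fun t : T => t.2.2 0 k : R).
  move=> t.
  apply: (@continuous_comp _ _ _ (fun t : T => t.2.2) (fun u => u 0 k)).
    apply: (@continuous_comp _ _ _ (fun t : T => t.2) snd).
      exact: cvg_snd.
    exact: cvg_snd.
  exact: coord_continuous.
have cp : Ccontinuous p.
  apply: Ccontinuous_det => i j.
  under eq_fun do rewrite mul_mx_diag !mxE.
  apply: CcontinuousD; first exact: Ccontinuous_cst.
  under eq_fun do rewrite -mulN1r.
  apply: CcontinuousM; first exact: Ccontinuous_cst.
  apply: CcontinuousM; first exact: Ccontinuous_cst.
  apply: CcontinuousM; first by split=> //= t; exact: cvg_cst.
  by split=> /=; [exact: cre|exact: cim].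
(* The cubes only supply boundedness; the closed set [D] below then cuts out the unit polydisc. *)
pose I1 : set R := `[-1, 1]%classic.
pose cube : set 'rV[R]_n := [set u | forall k, I1 (u 0 k)].
pose B : set T := `[0, r + 1]%classic `*` (cube `*` cube).
have cB : compact B.
  apply: compact_setX; first exact: segment_compact.
  by apply: compact_setX; apply: (@rV_compact _ _ (fun=> I1)) => _;
    exact: segment_compact.
pose D : set T := [set t : T | forall k, t.2.1 0 k ^+ 2 + t.2.2 0 k ^+ 2 <= 1].
have cD : closed D.
  have -> : D = \bigcap_k
      ((fun t : T => t.2.1 0 k ^+ 2 + t.2.2 0 k ^+ 2 : R) @^-1`
       [set x | x <= 1]).
    by apply/seteqP; split=> t /= Dt k; [move=> _ /=|]; exact: Dt.
  apply: closed_bigI => k _; apply: preimage_closed; last exact: closed_le.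
  move=> t _; under eq_fun do rewrite !expr2.
  exact: (cvgD (cvgM (cre k t) (cre k t)) (cvgM (cim k t) (cim k t))).
have DE t : D t <-> polydisc 1 (w t).
  split=> Dt k.
    rewrite mxE normc_def /= lecR -[1]sqrtr1 ler_wsqrtr //; exact: Dt.
  have := Dt k; rewrite mxE normc_def /= lecR -[X in _ <= X]sqrtr1.
  by rewrite ler_psqrt // ?nnegrE ?addr_ge0 ?sqr_ge0.
(* Writing z = s w with w in the unit polydisc turns the radius of a zero into
   the coordinate s, which is minimised over the compact set K. *)
pose K := B `&` (D `&` [set t | p t = 0]).
have cK : compact K.
  apply: compact_closedI => //; apply: closedI => //.
  exact: Ccontinuous_closed_eq0.
(* Here s need not be the exact radius of z: every s in (0, r + 1] whose polydisc contains the zero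
   occurs as a first coordinate on [K]. *)
have inK z (s : R) : 0 < s -> s <= r + 1 -> polydisc s z ->
    \det (1%:M - A *m diag_mx z) = 0 -> exists2 t : T, K t & t.1 = s.
  move=> s0 sr zs dz.
  pose t : T := (s, (\row_k complex.Re (z 0 k / s%:C),
                     \row_k complex.Im (z 0 k / s%:C))).
  have wt : w t = s%:C^-1 *: z.
    by apply/rowP => k; rewrite !mxE mulrC; case: (_ * _).
  have sC0 : s%:C != 0 by rewrite (inj_eq (@complexI R)) gt_eqF.
  have Dt : D t.
    apply/DE => k; rewrite wt mxE normrM normfV mulrC.
    rewrite [`|s%:C|]ger0_norm ?ler0c ?(ltW s0) //.
    rewrite ler_pdivrMr ?ltcR // -rmorphM mul1r; exact: zs.
  exists t => //; split; last first.
    by split=> //=; rewrite /p wt scalerA mulfV // scale1r.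
  split=> /=; first by rewrite in_itv /= (ltW s0).
  split=> k; have := Dt k; rewrite /I1 /= !mxE in_itv /= -ler_norml;
    rewrite -[X in _ -> _ <= X]sqrtr1 -sqrtr_sqr => h;
    rewrite ler_psqrt ?nnegrE ?sqr_ge0 //; apply: le_trans h.
    by rewrite lerDl sqr_ge0.
  by rewrite lerDr sqr_ge0.
have [[t0 Kt0]|K0] := pselect (K !=set0); last first.
  exists (r + 1); first by rewrite ltrDl.
  move=> z zr; apply/eqP => dz; apply: K0.
  by have [||t Kt _] := inK z (r + 1) _ _ zr dz; [lra|exact: lexx|exists t].
have cc1 : {within K, continuous (fun t : T => t.1 : R)}.
  by apply: continuous_subspaceT.
have [t /set_mem [[/= t1 _] [Dt pt]] tmin] :=
  compact_EVT_min (ex_intro _ _ Kt0) cK cc1.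
move: t1; rewrite in_itv /= => /andP[t10 t1r].
(* If the minimum were at most r, then s w would be a zero in the polydisc of radius r. *)
have rt : r < t.1.
  rewrite ltNge; apply/negP => tr.
  suff /nz : polydisc r (t.1%:C *: w t) by rewrite -/(p t) pt eqxx.
  move=> k; rewrite mxE normrM ger0_norm ?ler0c //.
  rewrite -[r%:C]mulr1.
  by apply: ler_pM => //; [rewrite ler0c|rewrite lecR|exact: ((DE t).1 Dt k)].
(* A zero within the midpoint radius would give a point of [K] below the minimum. *)
exists ((r + t.1) / 2); first lra.
move=> z zr; apply/eqP => dz.
have [||s Ks s1] := inK z ((r + t.1) / 2) _ _ zr dz; [lra|lra|].
by have := tmin s (mem_set Ks); rewrite s1; lra.
Qed.

Local Notation normc := ComplexField.Normc.normc.

Lemma normc_ge0 (c : R[i]) : 0 <= normc c.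
Proof. by case: c => a b; exact: sqrtr_ge0. Qed.

Lemma euclidean_norm_diag z v r : 0 <= r -> polydisc r z ->
  euclidean_norm (diag_mx z *m v) <= r * euclidean_norm v.
Proof.
move=> r0 zr.
rewrite -[X in X * _](ger0_norm r0) -sqrtr_sqr -sqrtrM ?sqr_ge0 //.
apply: ler_wsqrtr; rewrite mulr_sumr; apply: ler_sum => k _.
rewrite mul_diag_mx mxE ComplexField.Normc.normcM exprMn.
apply: ler_wpM2r; first exact: sqr_ge0.
by apply: lerXn2r; rewrite ?nnegrE ?normc_ge0 // -lecR; exact: zr.
Qed.

Lemma euclidean_norm_delta (k : 'I_n) (c : R[i]) :
  euclidean_norm (c *: delta_mx k 0) = normc c.
Proof.
rewrite /euclidean_norm (bigD1 k) //= big1 => [|j /negbTE jk].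
  by rewrite !mxE !eqxx mulr1 addr0 sqrtr_sqr ger0_norm ?normc_ge0.
by rewrite !mxE jk mulr0 ComplexField.Normc.normc0 expr0n.
Qed.

(** One direction bounds the image coordinatewise; the other tests the matrix on the k-th basis
    vector, which it multiplies by z_k. *)
Lemma operator_norm_diag z r : 0 <= r ->
  operator_norm (diag_mx z) <= r <-> polydisc r z.
Proof.
move=> r0; split=> [zr k|zr]; last first.
  apply: ge_sup.
    exists (euclidean_norm (diag_mx z *m 0)), 0 => //=.
    rewrite /euclidean_norm big1 ?sqrtr0 // => k _.
    by rewrite mxE ComplexField.Normc.normc0 expr0n.
  move=> _ [v /= v1 <-]; apply: le_trans (euclidean_norm_diag _ r0 zr) _.
  by rewrite -[leRHS]mulr1 ler_wpM2l.
rewrite lecR; apply: le_trans zr; apply: ub_le_sup.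
  (* The supremum dominates its members only if the set is bounded above; the sum of the moduli is a
     crude bound. *)
  have s0 : 0 <= \sum_j normc (z 0 j).
    by apply: sumr_ge0 => j _; exact: normc_ge0.
  exists (\sum_j normc (z 0 j)) => _ [v /= v1 <-].
  apply: (@le_trans _ _ ((\sum_j normc (z 0 j)) * euclidean_norm v)).
    apply: euclidean_norm_diag => // j; rewrite lecR (bigD1 j) //= lerDl.
    by apply: sumr_ge0 => ? _; exact: normc_ge0.
  by rewrite -[leRHS]mulr1 ler_wpM2l.
exists (delta_mx k 0) => /=.
  rewrite -[delta_mx _ _]scale1r euclidean_norm_delta.
  by rewrite ComplexField.Normc.normc1.
rewrite -(euclidean_norm_delta k); congr euclidean_norm.
apply/matrixP => i j; rewrite mul_diag_mx !mxE.
by case: eqP => [->|]; rewrite ?mulr0.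
Qed.

Lemma mu_diagonal_lt1 (A : 'M[R[i]]_n) :
  mu (@diagonal_matrices R n) A < 1 <->
  forall z, polydisc 1 z -> \det (1%:M - A *m diag_mx z) != 0.
Proof.
have singE X : singularizing (@diagonal_matrices R n) A X <->
    exists2 z, X = diag_mx z & \det (1%:M - A *m diag_mx z) = 0.
  split=> [[/diag_mxP [z ->] dz]|[z -> dz]]; first by exists z.
  by split=> //; exact: diag_mx_is_diag.
have lb r : 0 <= r ->
    (forall z, polydisc r z -> \det (1%:M - A *m diag_mx z) != 0) ->
    lbound [set operator_norm X | X in
      singularizing (@diagonal_matrices R n) A] r.
  move=> r0 nz _ [X /singE [z -> dz] <-].
  rewrite leNgt; apply/negP => /ltW /operator_norm_diag zr.
  by have := nz z (zr r0); rewrite dz eqxx.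
(* Radius 0 contains only z = 0, where the determinant is 1. Extending it bounds the infimum below
   by a positive number, so its inverse is not the default value at 0. *)
have [r r_gt0 nzr] : exists2 r, 0 < r &
    forall z, polydisc r z -> \det (1%:M - A *m diag_mx z) != 0.
  apply: det_neq0_polydisc_extend => // z z0.
  have -> : z = 0.
    by apply/rowP => k; apply/eqP; rewrite mxE -normr_le0; exact: z0.
  by rewrite raddf0 mulmx0 subr0 det1 oner_eq0.
rewrite /mu; case: asboolP => [S0|S0]; last first.
  split=> // _ z _; apply/eqP => dz; apply: S0.
  by exists (diag_mx z); apply/singE; exists z.
have N0 : [set operator_norm X | X in
    singularizing (@diagonal_matrices R n) A] !=set0 by exact: image_nonempty.
have inf_gt0 := lt_le_trans r_gt0 (lb_le_inf N0 (lb r (ltW r_gt0) nzr)).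
rewrite invf_lt1 //; split=> [inf1 z z1|nz].
  apply/eqP => dz; move: inf1; rewrite ltNge => /negP; apply.
  apply: (@le_trans _ _ (operator_norm (diag_mx z))).
    apply: ge_inf; first by exists r; exact: lb (ltW r_gt0) nzr.
    by exists (diag_mx z) => //; apply/singE; exists z.
  exact/operator_norm_diag.
(* The unit polydisc alone would give only an infimum of at least 1; a radius s > 1 makes the
   inequality strict. *)
have [s s1 nzs] := det_neq0_polydisc_extend ler01 nz.
exact: lt_le_trans s1 (lb_le_inf N0 (lb s (le_trans ler01 (ltW s1)) nzs)).
Qed.

End DiagonalSingularValue.

(** * Determinants of sizes 2 and 3 *)

Lemma det_mx22 (K : comNzRingType) (M : 'M[K]_2) :
  \det M = M 0 0 * M 1 1 - M 0 1 * M 1 0.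
Proof.
(* Entries indexed by nat make ring identify ordinals with equal values. *)
pose F i j := M (inord i) (inord j).
have MF i j : M i j = F i j by rewrite /F !inord_val.
rewrite (expand_det_row _ ord0) !big_ord_recl big_ord0 /cofactor !det_mx11.
rewrite !mxE !MF /= /bump /=; ring.
Qed.

Lemma det_mx33 (K : comNzRingType) (M : 'M[K]_3) :
  \det M = M 0 0 * (M 1 1 * M 2 2 - M 1 2 * M 2 1)
         - M 0 1 * (M 1 0 * M 2 2 - M 1 2 * M 2 0)
         + M 0 2 * (M 1 0 * M 2 1 - M 1 1 * M 2 0).
Proof.
pose F i j := M (inord i) (inord j).
have MF i j : M i j = F i j by rewrite /F !inord_val.
rewrite (expand_det_row _ ord0) !big_ord_recl big_ord0 /cofactor !det_mx22.
rewrite !mxE !MF /= /bump /=; ring.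
Qed.

(** * The Schur complement and the function G *)

Section Schur.
Variable R : realType.
Implicit Types A : 'M[R[i]]_3.

(** This is G, the linear fractional transform a_11 + (a_12, a_13) Z (I - A' Z)^-1 (a_21, a_31)^T
    with Z = diag(z2, z3). *)
Definition transfer A (z2 z3 : R[i]) : R[i] := (A *m eta A z2 z3) 0 0.

Lemma mul_mx_eta A (z2 z3 : R[i]) k :
  (A *m eta A z2 z3) k 0 =
  A k 0 + A k 1 * (z2 * gamma1 A z2 z3) + A k 2 * (z3 * gamma2 A z2 z3).
Proof.
pose F i j := A (inord i) (inord j).
have AF i j : A i j = F i j by rewrite /F !inord_val.
rewrite mxE !big_ord_recl big_ord0 !mxE !AF /= /bump /=; ring.
Qed.

Lemma resolvent_mxE A (z2 z3 : R[i]) i j :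
  resolvent_mx A z2 z3 i j =
  (i == j)%:R - A (rshift 1 i) (rshift 1 j) * [:: z2; z3]`_j.
Proof. by rewrite /resolvent_mx mul_mx_diag !mxE. Qed.

(** The defining equation (I - A' Z) gamma = (a_21, a_31)^T rearranges to (a_21, a_31)^T + A' Z
    gamma = gamma, whose left side is the lower part of A eta. *)
Lemma mul_mx_eta_gamma A (z2 z3 : R[i]) : \det (resolvent_mx A z2 z3) != 0 ->
  (A *m eta A z2 z3) 1 0 = gamma1 A z2 z3 /\
  (A *m eta A z2 z3) 2 0 = gamma2 A z2 z3.
Proof.
move=> dR.
have /matrixP e : resolvent_mx A z2 z3 *m gamma_vec A z2 z3 =
                  dlsubmx (A : 'M_(1 + 2)).
  by rewrite mulmxA mulmxV ?mul1mx // unitmxE unitfE.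
rewrite !mul_mx_eta.
pose F i j := A (inord i) (inord j).
have AF i j : A i j = F i j by rewrite /F !inord_val.
have i1 : lift ord0 ord0 = 1 :> 'I_2 by apply: val_inj.
split; [have := e 0 0|have := e 1 0];
  rewrite mxE !big_ord_recl big_ord0 !resolvent_mxE i1;
  rewrite -/(gamma1 _ _ _) -/(gamma2 _ _ _) !mxE !AF /= => <-; ring.
Qed.

Lemma det_1B_mul_diag A (z : 'rV[R[i]]_3) :
  \det (resolvent_mx A (z 0 1) (z 0 2)) != 0 ->
  \det (1%:M - A *m diag_mx z) =
  \det (resolvent_mx A (z 0 1) (z 0 2)) *
    (1 - z 0 0 * transfer A (z 0 1) (z 0 2)).
Proof.
move=> /mul_mx_eta_gamma.
rewrite /transfer !mul_mx_eta det_mx22 det_mx33 !resolvent_mxE.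
rewrite !mul_mx_diag !mxE.
pose F i j := A (inord i) (inord j).
have AF i j : A i j = F i j by rewrite /F !inord_val.
rewrite !AF /=.
set g1 := gamma1 _ _ _; set g2 := gamma2 _ _ _ => -[e1 e2].
(* Eliminating a_21 and a_31 in favour of gamma_1 and gamma_2 leaves a polynomial identity without
   inverses. *)
have -> : F 1 0 = g1 - F 1 1 * (z 0 1 * g1) - F 1 2 * (z 0 2 * g2).
  by rewrite -[X in X - _ - _]e1; ring.
have -> : F 2 0 = g2 - F 2 1 * (z 0 1 * g1) - F 2 2 * (z 0 2 * g2).
  by rewrite -[X in X - _ - _]e2; ring.
ring.
Qed.

(** The form is |eta|^2 - |A eta|^2, that is 1 + |z2 gamma_1|^2 + |z3 gamma_2|^2 - |G|^2 -
    |gamma_1|^2 - |gamma_2|^2, and the weighted terms cancel all but 1 - |G|^2. *)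
Lemma form_transfer A (z2 z3 : R[i]) : \det (resolvent_mx A z2 z3) != 0 ->
  (1 - `|z2| ^+ 2) * `|gamma1 A z2 z3| ^+ 2
          + (1 - `|z3| ^+ 2) * `|gamma2 A z2 z3| ^+ 2
          + ((eta A z2 z3) ^t* *m (1%:M - A ^t* *m A) *m eta A z2 z3) 0 0
  = 1 - `|transfer A z2 z3| ^+ 2.
Proof.
move=> /mul_mx_eta_gamma [e1 e2].
have normE n (v : 'cV[R[i]]_n) : (v ^t* *m v) 0 0 = \sum_i `|v i 0| ^+ 2.
  by rewrite mxE; apply: eq_bigr => i _; rewrite !mxE normCK mulrC.
rewrite mulmxBr mulmx1 mulmxBl !mulmxA -[_ *m A *m _]mulmxA.
have -> : (eta A z2 z3) ^t* *m A ^t* = (A *m eta A z2 z3) ^t*.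
  by rewrite trmx_mul map_mxM.
rewrite mxE [(- (_ : 'M__)) 0 0]mxE !normE !big_ord_recl !big_ord0.
have i1 : lift ord0 ord0 = 1 :> 'I_3 by apply: val_inj.
have i2 : lift ord0 (lift ord0 ord0) = 2 :> 'I_3 by apply: val_inj.
rewrite i1 i2 -/(transfer _ _ _) e1 e2 !mxE /= !normrM !exprMn normr1.
ring.
Qed.

Lemma det_neq0_polydisc3P A :
  (forall z, @polydisc R 3 1 z -> \det (1%:M - A *m diag_mx z) != 0) <->
  (forall z2 z3 : R[i], `|z2| <= 1 -> `|z3| <= 1 ->
      \det (resolvent_mx A z2 z3) != 0 /\ `|transfer A z2 z3| < 1).
Proof.
split=> [nz z2 z3 z21 z31|nz z z1]; last first.
  have [dR t1] := nz _ _ (z1 1) (z1 2).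
  rewrite det_1B_mul_diag // mulf_neq0 // subr_eq0; apply/eqP => e.
  suff : `|z 0 0 * transfer A (z 0 1) (z 0 2)| < 1 by rewrite -e normr1 ltxx.
  by rewrite normrM; apply: le_lt_trans t1; rewrite ler_piMl // z1.
pose zz (c : R[i]) : 'rV[R[i]]_3 := \row_(k < 3) [:: c; z2; z3]`_k.
have zz1 c k : `|c| <= 1 -> `|zz c 0 k| <= 1.
  by rewrite mxE; case: k => [[|[|[|]]]].
(* The factorisation presupposes a nonsingular resolvent, so this comes first, by direct expansion
   at z1 = 0. *)
have dR : \det (resolvent_mx A z2 z3) != 0.
  have := nz (zz 0) (zz1 0 ^~ _); rewrite normr0 => /(_ ler01).
  suff -> : \det (1%:M - A *m diag_mx (zz 0)) =
            \det (resolvent_mx A z2 z3) by [].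
  rewrite det_mx22 det_mx33 !resolvent_mxE !mul_mx_diag !mxE.
  pose F i j := A (inord i) (inord j).
  have AF i j : A i j = F i j by rewrite /F !inord_val.
  rewrite !AF /=; ring.
(* If |G| >= 1, then z1 = 1/G lies in the closed disc and annihilates the factor 1 - z1 G. *)
split=> //; rewrite real_ltNge ?normr_real ?real1 //; apply/negP => t1.
have t0 : transfer A z2 z3 != 0 by rewrite -normr_gt0 (lt_le_trans ltr01).
have c1 : `|(transfer A z2 z3)^-1| <= 1.
  by rewrite normfV invf_le1 // normr_gt0.
have := nz (zz (transfer A z2 z3)^-1) (fun k => zz1 _ k c1).
by rewrite det_1B_mul_diag !mxE //= mulVf // subrr mulr0 eqxx.
Qed.

End Schur.

Theorem theorem2p15 (R : realType) (x : 'rV[R[i]]_7) :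
  G_3_3_111 x <->
  exists A : 'M[R[i]]_3,
    [/\ x 0 0 = A 0 0,
        x 0 1 = A 1 1,
        x 0 2 = A 0 0 * A 1 1 - A 0 1 * A 1 0 &
        x 0 3 = A 2 2] /\
    [/\ x 0 4 = A 0 0 * A 2 2 - A 0 2 * A 2 0,
        x 0 5 = A 1 1 * A 2 2 - A 1 2 * A 2 1 &
        x 0 6 = \det A] /\
    forall z2 z3 : R[i], `|z2| <= 1 -> `|z3| <= 1 ->
      \det (resolvent_mx A z2 z3) != 0 /\
      0 < (1 - `|z2| ^+ 2) * `|gamma1 A z2 z3| ^+ 2
          + (1 - `|z3| ^+ 2) * `|gamma2 A z2 z3| ^+ 2
          + ((eta A z2 z3) ^t* *m (1%:M - A ^t* *m A) *m eta A z2 z3) 0 0.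
Proof.
(* The same matrix serves both sides, so the coordinates and the condition on mu are matched
   separately for a fixed A. *)
have piE (A : 'M[R[i]]_3) : pi_3_3_111 A = x <->
    [/\ x 0 0 = A 0 0,
        x 0 1 = A 1 1,
        x 0 2 = A 0 0 * A 1 1 - A 0 1 * A 1 0 &
        x 0 3 = A 2 2] /\
    [/\ x 0 4 = A 0 0 * A 2 2 - A 0 2 * A 2 0,
        x 0 5 = A 1 1 * A 2 2 - A 1 2 * A 2 1 &
        x 0 6 = \det A].
  split=> [<-|[[e0 e1 e2 e3] [e4 e5 e6]]]; first by rewrite !mxE.
  apply/rowP => k; rewrite mxE.
  case: k => [[|[|[|[|[|[|[|]]]]]]]] // lt_k7 /=;
    [rewrite -e0|rewrite -e1|rewrite -e2|rewrite -e3
    |rewrite -e4|rewrite -e5|rewrite -e6]; congr (x 0 _); exact: val_inj.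
have muE (A : 'M[R[i]]_3) : mu (@E_3_3_111 R) A < 1 <->
    forall z2 z3 : R[i], `|z2| <= 1 -> `|z3| <= 1 ->
      \det (resolvent_mx A z2 z3) != 0 /\
      0 < (1 - `|z2| ^+ 2) * `|gamma1 A z2 z3| ^+ 2
          + (1 - `|z3| ^+ 2) * `|gamma2 A z2 z3| ^+ 2
          + ((eta A z2 z3) ^t* *m (1%:M - A ^t* *m A) *m eta A z2 z3) 0 0.
  apply: iff_trans (mu_diagonal_lt1 A) _.
  apply: iff_trans (det_neq0_polydisc3P A) _.
  split=> h z2 z3 z21 z31; have [dR] := h z2 z3 z21 z31;
    by rewrite form_transfer // subr_gt0 expr_lt1.
split=> [[A muA /piE [e1 e2]]|[A [e1 [e2 h]]]].
  by exists A; split=> //; split=> //; exact/muE.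
by exists A; [exact/muE|exact/piE].
Qed.
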